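(* For every $\theta=(\theta_1,\dots,\theta_n)\in\mathbb{R}^{nd}$ (with $\theta_j\in\mathbb{R}^d$), the optimization problem $$V(\theta)=\min_{\dot s_0^2,\dots,\dot s_N^2\ \geq 0}\ \left(\sum_{i=0}^{N-1}\frac{\Delta s_i}{\sqrt{\dot s_i^2}}\right)^2$$ subject to $$-\dot{\underline q}_j^2\ \leq\ \operatorname{sign}(p_i'\theta_j)\,(p_i'\theta_j)^2\,\dot s_i^2\ \leq\ \dot{\overline q}_j^2,\qquad i=0,\dots,N,\ j=1,\dots,n,$$ $$\ddot{\underline q}_j\ \leq\ \left(p_i''\theta_j-\frac{p_i'\theta_j}{2\Delta s_i}\right)\dot s_i^2+\frac{p_i'\theta_j}{2\Delta s_i}\,\dot s_{i+1}^2\ \leq\ \ddot{\overline q}_j,\qquad i=0,\dots,N-1,\ j=1,\dots,n,$$ in which the decision variables are the squared speeds $\dot s_i^2$ (each $\dot s_i^2$ is treated as a single real variable), is a convex optimization problem, i.e. its objective is a convex function of the decision variables and its feasible set is convex. Moreover, its solution is unique.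
   Context: $N,n,d$ are positive integers. $0=s_0<s_1<\dots<s_N=1$ are path points and $\Delta s_i=s_{i+1}-s_i>0$ for $i=0,\dots,N-1$. The function $p:\mathbb{R}\to\mathbb{R}^{1\times d}$ is a twice differentiable row-vector basis; $p_i'=p'(s_i)$ and $p_i''=p''(s_i)\in\mathbb{R}^{1\times d}$, so $p_i'\theta_j$ and $p_i''\theta_j$ are real numbers. For each joint $j=1,\dots,n$, the real constants $\dot{\underline q}_j,\dot{\overline q}_j$ are the lower and upper velocity limits and $\ddot{\underline q}_j,\ddot{\overline q}_j$ the lower and upper acceleration limits. $\operatorname{sign}(0)=0$. The objective is taken to be $+\infty$ when some $\dot s_i^2=0$ with $0\le i\le N-1$.
   Formalization: Uniqueness is proved (as ''at most one'', among feasible points with finite objective) only for the squared speeds at s_0,…,s_{N-1}; the last one, at s_N, does not enter the objective and need not be unique, so the literal claim is false. *)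

(* Defs.v *)
From HB Require Import structures.
From mathcomp Require Import all_boot all_order all_algebra.
From mathcomp Require Import all_classical all_reals all_analysis.
Set Implicit Arguments.
Unset Strict Implicit.
Unset Printing Implicit Defensive.
Import Order.TTheory GRing.Theory Num.Theory.
Import numFieldNormedType.Exports.
Local Open Scope classical_set_scope.
Local Open Scope ring_scope.
Local Open Scope convex_scope.

(* Extended-real-valued counterpart of [convex_function]; the convention
   0 * +oo = 0 makes the weights 0 and 1 harmless for functions > -oo. *)
Definition convex_efunction (R : numFieldType) (E : lmodType R)
    (E' := convex_lmodType E) (D : set E') (f : E' -> \bar R) :=
  forall t : {i01 R}, {in D &, forall x y : E',
    (f (x <| t |> y) <= t%:num%:E * f x + (1 - t%:num)%:E * f y)%E}.

(* The grid points 0, ..., N are indexed by 'I_N.+1 and the intervals by 'I_N;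
   interval i goes from grid point [idx i] (value i) to [nxt i] (value i + 1). *)
Definition idx (N : nat) (i : 'I_N) : 'I_N.+1 := widen_ord (leqnSn N) i.
Definition nxt (N : nat) (i : 'I_N) : 'I_N.+1 := lift ord0 i.

Definition Delta (R : realType) (N : nat) (s : 'I_N.+1 -> R) (i : 'I_N) : R :=
  s (nxt i) - s (idx i).

(* In everything below, the coordinate x 0 i of the decision vector stands for
   the squared speed at s i. *)
Definition nonneg_orthant (R : realType) (N : nat) : set 'rV[R]_N.+1 :=
  [set x | forall i, 0 <= x 0 i].

Definition objective (R : realType) (N : nat) (s : 'I_N.+1 -> R)
    (x : 'rV[R]_N.+1) : \bar R :=
  if [exists i : 'I_N, x 0 (idx i) == 0] then +oo%E
  else ((\sum_(i < N) Delta s i / Num.sqrt (x 0 (idx i))) ^+ 2)%:E.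

Definition dpath (R : realType) (N n d : nat) (s : 'I_N.+1 -> R)
    (p : R -> 'rV[R]_d) (theta : 'I_n -> 'cV[R]_d) (i : 'I_N.+1) (j : 'I_n) : R :=
  (derive1 p (s i) *m theta j) 0 0.

Definition ddpath (R : realType) (N n d : nat) (s : 'I_N.+1 -> R)
    (p : R -> 'rV[R]_d) (theta : 'I_n -> 'cV[R]_d) (i : 'I_N.+1) (j : 'I_n) : R :=
  (derive1n 2 p (s i) *m theta j) 0 0.

Definition velocity_limits (R : realType) (N n d : nat) (s : 'I_N.+1 -> R)
    (p : R -> 'rV[R]_d) (vlo vhi : 'I_n -> R) (theta : 'I_n -> 'cV[R]_d)
    (x : 'rV[R]_N.+1) : Prop :=
  forall (i : 'I_N.+1) (j : 'I_n),
    let a := dpath s p theta i j in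
    - (vlo j ^+ 2) <= Num.sg a * a ^+ 2 * x 0 i <= vhi j ^+ 2.

Definition acceleration_limits (R : realType) (N n d : nat) (s : 'I_N.+1 -> R)
    (p : R -> 'rV[R]_d) (alo ahi : 'I_n -> R) (theta : 'I_n -> 'cV[R]_d)
    (x : 'rV[R]_N.+1) : Prop :=
  forall (i : 'I_N) (j : 'I_n),
    let a := dpath s p theta (idx i) j in
    let b := ddpath s p theta (idx i) j in
    alo j <= (b - a / (2 * Delta s i)) * x 0 (idx i)
             + a / (2 * Delta s i) * x 0 (nxt i) <= ahi j.

Definition feasible_set (R : realType) (N n d : nat) (s : 'I_N.+1 -> R)
    (p : R -> 'rV[R]_d) (vlo vhi alo ahi : 'I_n -> R)
    (theta : 'I_n -> 'cV[R]_d) : set 'rV[R]_N.+1 :=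
  [set x | [/\ @nonneg_orthant R N x,
               velocity_limits s p vlo vhi theta x
             & acceleration_limits s p alo ahi theta x]].

Definition V (R : realType) (N n d : nat) (s : 'I_N.+1 -> R)
    (p : R -> 'rV[R]_d) (vlo vhi alo ahi : 'I_n -> R)
    (theta : 'I_n -> 'cV[R]_d) : \bar R :=
  ereal_inf (objective s @` feasible_set s p vlo vhi alo ahi theta).

(* As usual for extended-valued objectives, a point where the objective is +oo
   lies outside the domain of the problem and never counts as a solution.  The objective
   does not involve the last coordinate of x, and the constraints confine that
   coordinate only to an interval.  Hence a solution can be unique only in its
   coordinates 0, ..., N - 1: for N = n = d = 1, p(u) = u, theta = 1, velocity
   limits -1, 1 and acceleration limits -1, 1, every (1, b) with 0 <= b <= 1
   is a solution. *)
Definition is_solution (R : realType) (N n d : nat) (s : 'I_N.+1 -> R)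
    (p : R -> 'rV[R]_d) (vlo vhi alo ahi : 'I_n -> R)
    (theta : 'I_n -> 'cV[R]_d) (x : 'rV[R]_N.+1) : Prop :=
  [/\ feasible_set s p vlo vhi alo ahi theta x,
      (objective s x < +oo)%E
    & objective s x = V s p vlo vhi alo ahi theta].

(* Main.v *)
(** Each map [u |-> 1 / sqrt u] is strictly convex on the positive reals, since
its graph lies strictly above its tangents.  Hence the total travel time is
strictly convex in the coordinates 0, ..., N - 1, and so is its square.  If two
solutions differed in one of these coordinates, their midpoint would be feasible
with a strictly smaller objective. *)

Require Import Defs.
From HB Require Import structures.
From mathcomp Require Import all_boot all_order all_algebra.
From mathcomp Require Import all_classical all_reals all_analysis.
From mathcomp Require Import ring lra.
Set Implicit Arguments.
Unset Strict Implicit.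
Unset Printing Implicit Defensive.
Import Order.TTheory GRing.Theory Num.Theory.
Import numFieldNormedType.Exports.
Local Open Scope classical_set_scope.
Local Open Scope ring_scope.

Local Open Scope convex_scope.

Section InverseSquareRoot.
Context {R : rcfType}.
Implicit Types u v w t : R.

(* With [a = sqrt u] and [b = sqrt w], the gap to the tangent at [w] is
   (a - b)^2 (a + 2 b) / (2 a b^3). *)
Lemma sqrtV_tangent u w : 0 < u -> 0 < w ->
  (Num.sqrt w)^-1 - (u - w) / (2 * Num.sqrt w ^+ 3) <= (Num.sqrt u)^-1
    ?= iff (u == w).
Proof.
move=> u0 w0.
rewrite -{1 3}(sqr_sqrtr (ltW u0)) -{2 4}(sqr_sqrtr (ltW w0)).
have : 0 < Num.sqrt u by rewrite sqrtr_gt0.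
have : 0 < Num.sqrt w by rewrite sqrtr_gt0.
move: (Num.sqrt u) (Num.sqrt w) => a b b0 a0.
have gapE : a^-1 - (b^-1 - (a ^+ 2 - b ^+ 2) / (2 * b ^+ 3)) =
    (a - b) ^+ 2 * ((a + 2 * b) / (2 * a * b ^+ 3)).
  by field; rewrite !gt_eqF.
have c0 : 0 < (a + 2 * b) / (2 * a * b ^+ 3).
  by rewrite divr_gt0 ?addr_gt0 ?mulr_gt0 ?exprn_gt0.
split; first by rewrite -subr_ge0 gapE mulr_ge0 ?sqr_ge0 ?ltW.
rewrite eq_sym -subr_eq0 gapE mulf_eq0 (gt_eqF c0) orbF sqrf_eq0 subr_eq0.
by rewrite eqrXn2 ?ltW.
Qed.

(** Averaging the values at [u] and [v] of the tangent at [w] gives back the value at [w], because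
    the linear terms cancel; the tangent lies below the graph at both points. *)
Lemma sqrtV_convex t u v : 0 < t < 1 -> 0 < u -> 0 < v ->
  (Num.sqrt (t * u + (1 - t) * v))^-1
    <= t * (Num.sqrt u)^-1 + (1 - t) * (Num.sqrt v)^-1 ?= iff (u == v).
Proof.
move=> /andP[t0 t1] u0 v0; set w := t * u + (1 - t) * v.
have t1' : 0 < 1 - t by rewrite subr_gt0.
have w0 : 0 < w by rewrite addr_gt0 ?mulr_gt0.
have [lu equ] := sqrtV_tangent u0 w0.
have [lv eqv] := sqrtV_tangent v0 w0.
set c := 2 * Num.sqrt w ^+ 3 in lu equ lv eqv.
have E : (Num.sqrt w)^-1 = t * ((Num.sqrt w)^-1 - (u - w) / c) +
    (1 - t) * ((Num.sqrt w)^-1 - (v - w) / c).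
  by rewrite /w; ring.
split; first by rewrite E lerD ?ler_pM2l.
have [uv|uv] := eqVneq u v.
  by rewrite /w uv -!mulrDl subrKC !mul1r eqxx.
(* For [u != v] strictness at [u] suffices: [u = w] would give [(1 - t) * (u - v) = 0]. *)
apply: lt_eqF; rewrite E ltr_leD ?ler_pM2l // ltr_pM2l // lt_neqAle lu andbT equ.
apply: contra_neq uv => uw.
suff: (1 - t) * (u - v) = 0.
  by move/eqP; rewrite mulf_eq0 gt_eqF //= subr_eq0 => /eqP.
by transitivity (u - w); [rewrite /w; ring | rewrite -uw subrr].
Qed.

End InverseSquareRoot.

Lemma conv_mxE {R : numDomainType} {m n : nat} (x y : 'M[R]_(m, n))
    (t : {i01 R}) i j :
  ((x : convex_lmodType 'M[R]_(m, n)) <| t |> y : 'M[R]_(m, n)) i j =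
  t%:num * x i j + (1 - t%:num) * y i j.
Proof. by rewrite /conv /= !mxE. Qed.

Section TravelTime.
Context {R : realType} {N : nat} (s : 'I_N.+1 -> R).
Context (s_incr : forall i : 'I_N, 0 < Delta s i).
Implicit Types (x y : 'rV[R]_N.+1) (t : {i01 R}).

(** The square root of the objective where coordinates 0, ..., N - 1 are positive. A zero coordinate
    would contribute 0 here, as [0^-1 = 0], so elsewhere it cannot replace the objective. *)
Definition travel_time x := \sum_(i < N) Delta s i / Num.sqrt (x 0 (idx i)).

Lemma travel_time_ge0 x : 0 <= travel_time x.
Proof. by apply: sumr_ge0 => i _; rewrite divr_ge0 ?sqrtr_ge0 // ltW. Qed.

Lemma objectiveE x : (forall i : 'I_N, 0 < x 0 (idx i)) ->
  objective s x = (travel_time x ^+ 2)%:E.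
Proof.
move=> x0; rewrite /objective ifF //; apply/existsP => -[i].
by rewrite gt_eqF.
Qed.

Lemma objective_ge0 x : (0 <= objective s x)%E.
Proof.
by rewrite /objective; case: ifP => _; rewrite ?leey // lee_fin sqr_ge0.
Qed.

Lemma objective_pinfty x :
  nonneg_orthant x -> objective s x = +oo%E \/ forall i : 'I_N, 0 < x 0 (idx i).
Proof.
move=> x0; rewrite /objective; case: ifPn => [_|]; first by left.
by rewrite negb_exists => /forallP xn0; right => i; rewrite lt_def xn0 x0.
Qed.

(** Term by term from [sqrtV_convex]; as the factors [Delta s i] are positive, equality of the sums
    forces equality in every term. *)
Lemma travel_time_convex x y t : 0 < t%:num < 1 ->
  (forall i : 'I_N, 0 < x 0 (idx i)) -> (forall i : 'I_N, 0 < y 0 (idx i)) ->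
  travel_time ((x : convex_lmodType 'rV[R]_N.+1) <| t |> y)
    <= t%:num * travel_time x + (1 - t%:num) * travel_time y
    ?= iff [forall i : 'I_N, x 0 (idx i) == y 0 (idx i)].
Proof.
move=> t01 x0 y0; rewrite !mulr_sumr -big_split /=.
apply: leif_sum => i _; rewrite conv_mxE.
rewrite ![_ * (Delta s i / _)]mulrCA -mulrDr.
have [le eq] := sqrtV_convex t01 (x0 i) (y0 i).
split; first by rewrite ler_pM2l.
by rewrite (inj_eq (mulfI _)) /= ?eq // gt_eqF.
Qed.

End TravelTime.

Lemma sqr_convex {R : realDomainType} (t a b : R) : 0 <= t <= 1 ->
  (t * a + (1 - t) * b) ^+ 2 <= t * a ^+ 2 + (1 - t) * b ^+ 2.
Proof.
move=> /andP[t0 t1]; rewrite -subr_ge0.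
have -> : t * a ^+ 2 + (1 - t) * b ^+ 2 - (t * a + (1 - t) * b) ^+ 2 =
   t * (1 - t) * (a - b) ^+ 2 by ring.
by rewrite mulr_ge0 ?sqr_ge0 // mulr_ge0 ?subr_ge0.
Qed.

(** The value [c] enters through an equation, so that [ring] can match it with a constraint
    evaluated at a convex combination. *)
Lemma convex_itv {R : realDomainType} (lo hi t a b c : R) : 0 <= t <= 1 ->
  lo <= a <= hi -> lo <= b <= hi -> c = t * a + (1 - t) * b -> lo <= c <= hi.
Proof.
by move=> /andP[? ?] /andP[? ?] /andP[? ?] ->; apply/andP; split; nra.
Qed.

(** Squaring is convex, and increasing on nonnegative reals, so it preserves the convexity of the
    travel time. *)
Lemma objective_convex {R : realType} {N : nat} (s : 'I_N.+1 -> R) :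
  (forall i : 'I_N, 0 < Delta s i) ->
  convex_efunction (E := 'rV[R]_N.+1) (@nonneg_orthant R N) (objective s).
Proof.
move=> s_incr t x y /[!inE] x0 y0.
(* At weights 0 and 1 the convention [0 * +oo = 0] drops one point, so an infinite value there need
   not make the bound infinite. For other weights it does. *)
have [->|tn0] := eqVneq t 0%:i01.
  by rewrite conv0 /= mul0e add0e subr0 mul1e.
have [->|tn1] := eqVneq t 1%:i01.
  by rewrite conv1 /= subrr mul0e adde0 mul1e.
have t0 : 0 < t%:num by rewrite lt_neqAle eq_sym tn0 ge0.
have t1 : t%:num < 1 by rewrite lt_neqAle tn1 le1.
have t1' : 0 < 1 - t%:num by rewrite subr_gt0.
have addNy (a : R) z : 0 < a -> (a%:E * objective s z != -oo)%E.
  move=> a0; rewrite gt_eqF // (lt_le_trans (ltNyr 0)) //.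
  by rewrite mule_ge0 ?objective_ge0 // lee_fin ltW.
have [->|{}x0] := objective_pinfty s x0.
  by rewrite gt0_muley ?lte_fin // addye ?leey // addNy.
have [->|{}y0] := objective_pinfty s y0.
  by rewrite gt0_muley ?lte_fin // addey ?leey // addNy.
rewrite !objectiveE // => [|i]; last by rewrite conv_mxE addr_gt0 ?mulr_gt0.
have t01 : 0 < t%:num < 1 by rewrite t0.
rewrite -!EFinM -EFinD lee_fin.
apply: (le_trans _ (sqr_convex _ _ _)); last by rewrite !ltW.
have le := (travel_time_convex s_incr t01 x0 y0).1.
by rewrite lerXn2r // nnegrE ?(le_trans _ le) ?travel_time_ge0.
Qed.

Section FeasibleSet.
Context {R : realType} {N n d : nat} (s : 'I_N.+1 -> R).
Context (p : R -> 'rV[R]_d) (vlo vhi alo ahi : 'I_n -> R).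
Context (theta : 'I_n -> 'cV[R]_d).

(** For fixed [theta] every constraint bounds a linear function of the squared speeds: the sign
    factor depends only on [s], [p] and [theta]. *)
Lemma feasible_set_convex :
  convex_set (M := 'rV[R]_N.+1) (feasible_set s p vlo vhi alo ahi theta).
Proof.
move=> x y t /[!inE] -[x0 xv xa] [y0 yv ya].
have t01 : 0 <= t%:num <= 1 by rewrite ge0 le1.
split=> [i|i j|i j] /=; rewrite !conv_mxE.
- by rewrite addr_ge0 ?mulr_ge0 // subr_ge0.
- by apply: (convex_itv t01 (xv i j) (yv i j)); ring.
- by apply: (convex_itv t01 (xa i j) (ya i j)); ring.
Qed.

Lemma is_solution_unique (s_incr : forall i : 'I_N, 0 < Delta s i) x y :
  is_solution s p vlo vhi alo ahi theta x ->
  is_solution s p vlo vhi alo ahi theta y ->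
  forall i : 'I_N, x 0 (idx i) = y 0 (idx i).
Proof.
move=> [Fx xoo xV] [Fy yoo yV].
have [x0 _ _] := Fx; have [y0 _ _] := Fy.
(* A solution has a finite objective, which forces positive coordinates. *)
have [xE|{}x0] := objective_pinfty s x0; first by rewrite xE in xoo.
have [yE|{}y0] := objective_pinfty s y0; first by rewrite yE in yoo.
have half01 : 0 < (2^-1 : R) < 1 by lra.
have [half_gt0 half_lt1] := andP half01.
pose h := Itv01 (ltW half_gt0) (ltW half_lt1).
have [le eq] := travel_time_convex s_incr (half01 : 0 < h%:num < 1) x0 y0.
suff /forallP xy : [forall i : 'I_N, x 0 (idx i) == y 0 (idx i)].
  by move=> i; apply/eqP.
have Sxy : travel_time s x = travel_time s y.
  apply/eqP; rewrite -(@eqrXn2 _ 2) ?travel_time_ge0 //.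
  by apply/eqP/EFin_inj; rewrite -!objectiveE // xV yV.
(* The bound at the midpoint is now the common travel time; by the equality case it remains to see
   that the midpoint is no faster than [x]. *)
rewrite -Sxy -mulrDl subrKC mul1r in le eq.
rewrite -eq eq_le le /=.
set z := (_ <| h |> _) in le eq *.
have Fz : feasible_set s p vlo vhi alo ahi theta z.
  by apply/set_mem/feasible_set_convex; exact/mem_set.
have z0 (i : 'I_N) : 0 < z 0 (idx i).
  by rewrite conv_mxE addr_gt0 ?mulr_gt0 ?subr_gt0.
(* The feasible midpoint has objective at least the infimum, which [x] attains. *)
rewrite -(@ler_pXn2r _ 2) ?nnegrE ?travel_time_ge0 //.
by rewrite -lee_fin -!objectiveE // xV; apply: ereal_inf_lbound; exists z.
Qed.

End FeasibleSet.

Theorem proposition1 (R : realType) (N n d : nat)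
    (hN : (0 < N)%N) (hn : (0 < n)%N) (hd : (0 < d)%N)
    (s : 'I_N.+1 -> R) (s_first : s ord0 = 0) (s_last : s ord_max = 1)
    (s_incr : forall i : 'I_N, 0 < Delta s i)
    (p : R -> 'rV[R]_d)
    (p_derivable : forall t : R, derivable p t 1)
    (p_twice_derivable : forall t : R, derivable (derive1 p) t 1)
    (vlo vhi alo ahi : 'I_n -> R)
    (theta : 'I_n -> 'cV[R]_d) :
  [/\ convex_efunction (E := 'rV[R]_N.+1) (@nonneg_orthant R N) (objective s),
      convex_set (M := 'rV[R]_N.+1) (feasible_set s p vlo vhi alo ahi theta)
    & forall x y : 'rV[R]_N.+1,
        is_solution s p vlo vhi alo ahi theta x ->
        is_solution s p vlo vhi alo ahi theta y ->
        forall i : 'I_N, x 0 (idx i) = y 0 (idx i)].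
Proof.
split.
- exact: objective_convex.
- exact: feasible_set_convex.
- by move=> x y; exact: is_solution_unique.
Qed.
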